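(* Let $f:X\to X$ be a continuous map on a metric space $(X,d)$, and let $\hat f:\mathcal{F}(X)\to\mathcal{F}(X)$ be its Zadeh extension, where $\mathcal{F}(X)$ is endowed with the endograph metric $d_E$. Then the following statements are equivalent: (i) the map $f$ has dense range, i.e. $f(X)$ is dense in $(X,d)$; (ii) the system $((\mathcal{F}(X),d_E),\hat f)$ is chain recurrent; (iii) the system $((\mathcal{F}(X),d_E),\hat f)$ is chain transitive; (iv) the system $((\mathcal{F}(X),d_E),\hat f)$ is chain mixing.
   Context: Write $\mathbb{I}=[0,1]$ and $\mathbb{N}=\{1,2,\dots\}$. Fuzzy sets: for $u:X\to\mathbb{I}$ set $u_\alpha=\{x: u(x)\ge\alpha\}$ for $\alpha\in(0,1]$ and $u_0=\overline{\{x:u(x)>0\}}$. $\mathcal{F}(X)$ (normal fuzzy sets) is the set of all upper-semicontinuous $u:X\to\mathbb{I}$ such that $u_0$ is compact and $u_1$ is non-empty. The Zadeh extension of a continuous $f:X\to X$ is $\hat f:\mathcal{F}(X)\to\mathcal{F}(X)$, $[\hat f(u)](x)=\sup\{u(y): y\in f^{-1}(\{x\})\}$ if $f^{-1}(\{x\})\neq\varnothing$ and $[\hat f(u)](x)=0$ otherwise (it is well defined). Endograph metric: on $X\times\mathbb{I}$ put $\overline d((x,\alpha),(y,\beta))=\max\{d(x,y),|\alpha-\beta|\}$, and let $\overline d_H(C_1,C_2)=\max\{\sup_{p\in C_1}\overline d(p,C_2),\sup_{q\in C_2}\overline d(q,C_1)\}$ be the Hausdorff distance between non-empty closed subsets of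 $X\times\mathbb{I}$ (with $\overline d(p,C)=\inf_{c\in C}\overline d(p,c)$). For $u\in\mathcal{F}(X)$ let $\mathrm{end}(u)=\{(x,\alpha)\in X\times\mathbb{I}:u(x)\ge\alpha\}$; then $d_E(u,v)=\overline d_H(\mathrm{end}(u),\mathrm{end}(v))$. The map $\hat f$ is $d_E$-continuous. Chains: let $g:Y\to Y$ be a continuous map on a metric space $(Y,r)$. For $\delta>0$ and $n\in\mathbb{N}$, a finite sequence $(y_j)_{j=0}^n$ in $Y$ is an $r$-$\delta$-chain from $y_0$ to $y_n$ of length $n$ if $r(g(y_j),y_{j+1})<\delta$ for all $0\le j\le n-1$. The system $(Y,g)$ is: chain recurrent if for every $y\in Y$ and $\delta>0$ there is an $r$-$\delta$-chain from $y$ to itself; chain transitive if for all $x,y\in Y$ and $\delta>0$ there is an $r$-$\delta$-chain from $x$ to $y$; chain mixing if for all $x,y\in Y$ and $\delta>0$ there is $n_0\in\mathbb{N}$ such that for every $n\ge n_0$ there is an $r$-$\delta$-chain from $x$ to $y$ of length $n$. *)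

(* Defs.v *)
From HB Require Import structures.
From mathcomp Require Import all_boot all_order all_algebra.
From mathcomp Require Import all_classical all_reals all_analysis.

Set Implicit Arguments.
Unset Strict Implicit.
Unset Printing Implicit Defensive.

Import Order.TTheory GRing.Theory Num.Theory.
Import numFieldNormedType.Exports.

Local Open Scope classical_set_scope.
Local Open Scope ring_scope.

Section fuzzy_sets.
Context {R : realType} {X : metricType R}.
Implicit Types (u : X -> R) (f : X -> X).

(* Mirrors the library's [lower_semicontinuous]. *)
Definition upper_semicontinuous u :=
  forall x a, u x < a -> \forall y \near x, u y < a.

Definition level u (a : R) : set X := [set x | a <= u x].

Definition support0 u : set X := closure [set x | 0 < u x].

Definition normal_fuzzy u :=
  [/\ forall x, 0 <= u x <= 1,
      upper_semicontinuous u,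
      compact (support0 u) &
      level u 1 !=set0].

Definition zadeh_fun f u (x : X) : R :=
  if `[< f @^-1` [set x] !=set0 >] then sup (u @` (f @^-1` [set x])) else 0.

Lemma closed_level u a : upper_semicontinuous u -> closed (level u a).
Proof.
move=> uscu; rewrite -openC openE => x /= /negP; rewrite -ltNge => xa.
by apply: filterS (uscu _ _ xa) => y ya /=; apply/negP; rewrite -ltNge.
Qed.

Lemma compact_level u a : normal_fuzzy u -> 0 < a -> compact (level u a).
Proof.
move=> [_ uscu cu _] a0; apply: subclosed_compact (closed_level uscu) cu _.
by move=> x /= ax; apply: subset_closure; exact: lt_le_trans ax.
Qed.

Lemma zadeh_fun_ub f u y : normal_fuzzy u -> u y <= zadeh_fun f u (f y).
Proof.
move=> [u01 _ _ _]; rewrite /zadeh_fun asboolT; last by exists y.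
apply: ub_le_sup; last by exists y.
by exists 1 => _ [z _ <-]; case/andP: (u01 z).
Qed.

Lemma zadeh_fun01 f u x : normal_fuzzy u -> 0 <= zadeh_fun f u x <= 1.
Proof.
move=> nu; have [u01 _ _ _] := nu.
have [[y fy]|n0] := pselect (f @^-1` [set x] !=set0).
  rewrite -fy; apply/andP; split.
    by apply: le_trans (zadeh_fun_ub f y nu); case/andP: (u01 y).
  rewrite /zadeh_fun asboolT; last by exists y.
  apply: ge_sup; first by exists (u y), y.
  by move=> _ [z _ <-]; case/andP: (u01 z).
by rewrite /zadeh_fun asboolF// lexx ler01.
Qed.

(* The supremum is attained, so the positive level sets of the Zadeh extension
   are the images of those of [u]. *)
Lemma level_zadeh_fun f u a : continuous f -> normal_fuzzy u -> 0 < a ->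
  level (zadeh_fun f u) a = f @` level u a.
Proof.
move=> cf nu a0; apply/seteqP; split => [x /= ax|_ [y ay <-]]; last first.
  exact: le_trans ay (zadeh_fun_ub f y nu).
move: ax; rewrite /level/= /zadeh_fun; case: asboolP => [ne|_]; last first.
  by rewrite leNgt a0.
move=> ax; pose S := f @^-1` [set x].
have hs : has_sup (u @` S).
  split; first by have [y Sy] := ne; exists (u y), y.
  by exists 1 => _ [z _ <-]; have [u01 _ _ _] := nu; case/andP: (u01 z).
pose B (e : R) := [set y | S y /\ a - e < u y].
pose F := filter_from [set e : R | 0 < e] B.
have FF : ProperFilter F.
  apply: filter_from_proper; last first.
    move=> e /= e0; have [_ [y Sy <-] ey] := sup_adherent e0 hs.
    by exists y; split=> //; apply: le_lt_trans ey; rewrite lerD2r.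
  apply: filter_from_filter; first by exists 1 => /=.
  move=> e1 e2 /= e10 e20; exists (Order.min e1 e2); first by rewrite /= lt_min e10.
  move=> y [Sy ey]; split; split=> //; apply: le_lt_trans ey; rewrite lerD2l lerN2.
    by rewrite ge_min lexx.
  by rewrite ge_min lexx orbT.
have a20 : 0 < a / 2 by rewrite divr_gt0.
have [] := compact_level nu a20 FF.
  exists (a / 2) => //= y [_]; rewrite {1}[a]splitr addrK; exact: ltW.
move=> p [_ clp]; exists p.
  rewrite /level/= leNgt; apply/negP => pa.
  have [_ uscu _ _] := nu.
  pose c := (u p + a) / 2.
  have pc : u p < c by rewrite midf_lt.
  have ca : c < a by rewrite midf_lt.
  have Bc : F (B (a - c)) by exists (a - c) => //=; rewrite subr_gt0.
  have [q [[_ qc] /= qc']] := clp _ _ Bc (uscu _ _ pc).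
  by move: qc; rewrite opprB addrCA subrr addr0 ltNge (ltW qc').
have clS : closed S.
  move/continuous_closedP: (cf); apply.
  by apply: compact_closed; [exact: metric_hausdorff|exact: compact_set1].
apply: clS => N Np; apply: clp Np.
by exists 1 => //= y [].
Qed.

Lemma closed_image_compact f (K : set X) :
  continuous f -> compact K -> closed (f @` K).
Proof.
move=> cf cK; apply: compact_closed; first exact: metric_hausdorff.
by apply: continuous_compact => //; exact: continuous_subspaceT.
Qed.

Lemma zadeh_fun_normal f u :
  continuous f -> normal_fuzzy u -> normal_fuzzy (zadeh_fun f u).
Proof.
move=> cf nu; have [u01 uscu cu [y y1]] := nu; split.
- by move=> x; exact: zadeh_fun01.
- move=> x a xa.
  have a0 : 0 < a by apply: le_lt_trans xa; case/andP: (zadeh_fun01 f x nu).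
  have clz : closed (level (zadeh_fun f u) a).
    rewrite level_zadeh_fun//; apply: closed_image_compact => //.
    exact: compact_level.
  have xN : (~` level (zadeh_fun f u) a) x.
    by move=> /=; apply/negP; rewrite -ltNge.
  have := open_nbhs_nbhs (conj (closed_openC clz) xN).
  by apply: filterS => z /= /negP; rewrite -ltNge.
- apply: (@subclosed_compact _ _ (f @` support0 u)).
  + exact: closed_closure.
  + by apply: continuous_compact => //; exact: continuous_subspaceT.
  + have /closure_id -> := closed_image_compact cf cu.
    apply: closureS => x /= x0.
    have : level (zadeh_fun f u) (zadeh_fun f u x) x by exact: lexx.
    rewrite level_zadeh_fun// => -[z zx <-]; exists z => //.
    by apply: subset_closure; exact: lt_le_trans zx.
- by exists (f y); exact: le_trans y1 (zadeh_fun_ub f y nu).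
Qed.

End fuzzy_sets.

Record fuzzy (R : realType) (X : metricType R) := Fuzzy {
  fuzzy_fun :> X -> R;
  fuzzy_normal : normal_fuzzy fuzzy_fun
}.

Definition zadeh (R : realType) (X : metricType R) (f : X -> X)
    (cf : continuous f) (u : fuzzy X) : fuzzy X :=
  Fuzzy (zadeh_fun_normal cf (@fuzzy_normal R X u)).

Section endograph_metric.
Context {R : realType} {X : metricType R}.
Implicit Types (p q : X * R) (C : set (X * R)) (u v : fuzzy X).

Definition dist_prod p q : R := Num.max (mdist p.1 q.1) `|p.2 - q.2|.

Definition dist_set p C : R := inf [set dist_prod p c | c in C].

(* [sup] is the real-valued supremum, with value 0 on sets that are not bounded
   above.  On endographs this does not happen: every point of an endograph is
   within 1 of X x {0}, which lies in every endograph. *)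
Definition dist_hausdorff C1 C2 : R :=
  Num.max (sup [set dist_set p C2 | p in C1])
          (sup [set dist_set q C1 | q in C2]).

Definition endograph u : set (X * R) :=
  [set p | 0 <= p.2 <= 1 /\ p.2 <= u p.1].

Definition dist_endo u v : R := dist_hausdorff (endograph u) (endograph v).

End endograph_metric.

Section chains.
Context {R : realType} {Y : Type}.
Context (r : Y -> Y -> R) (g : Y -> Y).

(* Only the values y_0, ..., y_n of the sequence matter. *)
Definition has_chain (delta : R) (n : nat) (a b : Y) :=
  exists y : nat -> Y, [/\ y 0%N = a, y n = b &
    forall j, (j < n)%N -> r (g (y j)) (y j.+1) < delta].

Definition chain_recurrent :=
  forall a (delta : R), 0 < delta ->
    exists2 n, (0 < n)%N & has_chain delta n a a.

Definition chain_transitive :=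
  forall a b (delta : R), 0 < delta ->
    exists2 n, (0 < n)%N & has_chain delta n a b.

Definition chain_mixing :=
  forall a b (delta : R), 0 < delta ->
    exists2 n0, (0 < n0)%N &
      forall n, (n0 <= n)%N -> has_chain delta n a b.

End chains.

(* Main.v *)
From HB Require Import structures.
Require Import Defs.
From mathcomp Require Import all_boot all_order all_algebra.
From mathcomp Require Import all_classical all_reals all_analysis.
From mathcomp Require Import lra.

(** Chain mixing implies chain transitivity and then chain recurrence, so two
implications carry the theorem.

Recurrence forces dense range.  Take u to be the indicator function of a point
x.  The last step of a chain from u to u brings some Zadeh image close to u in
the endograph metric, so the endograph of that image has a point close to
(x, 1).  Its height is positive, and at positive heights the Zadeh extension
lives over the range of f; hence x is close to the range
([chain_recurrent_dense]).

Dense range forces mixing.  The endograph metric does not see levels below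
delta: a new part of a fuzzy set may appear at height delta, and an old part
may vanish once its height has come down to delta.  So a chain can follow
the orbit of u truncated at a height that decreases by a small amount e at each
step, superposed with another orbit that ends at v, truncated at a height that
grows from 0 by e at each step.  Normality only asks that at every time one of
the two heights be at least 1, and this holds as soon as the length n satisfies
n e >= 2, which gives chains of every large length ([dense_chain_mixing]).

The orbit ending at v is produced backwards, by an approximate preimage under
the Zadeh extension ([near_image_dense]): upper semicontinuity and compactness
of the support reduce v to finitely many points, and each of them is moved to
an approximate preimage under f.

All approximations are expressed by the relation [near_image] between
functions.  It speaks of f pointwise, bounds the endograph distance
([dist_endo_near_image]) and is stable under maxima and truncations, so the
chain can be assembled without computing any Zadeh extension. *)

Import Order.TTheory GRing.Theory Num.Theory.

Local Open Scope classical_set_scope.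
Local Open Scope ring_scope.

(** * Fuzzy sets without the normality condition *)

Section subnormal.
Context {R : realType} {X : metricType R}.
Implicit Types (u v w : X -> R).

(** Truncating a normal fuzzy set at a height below 1 destroys normality, so the
closure properties are stated for the remaining three conditions. *)
Definition subnormal u :=
  [/\ forall x, 0 <= u x <= 1, upper_semicontinuous u & compact (support0 u)].

Lemma normal_subnormal u : normal_fuzzy u -> subnormal u.
Proof. by case. Qed.

Lemma subnormal_normal u x : subnormal u -> u x = 1 -> normal_fuzzy u.
Proof.
by move=> [u01 uscu cu] ux1; split => //; exists x; rewrite /level/= ux1.
Qed.

Lemma subnormal_max u v :
  subnormal u -> subnormal v -> subnormal (fun x => Num.max (u x) (v x)).
Proof.
move=> [u01 uscu cu] [v01 uscv cv]; split.
- move=> x; have /andP[u0 u1] := u01 x; have /andP[v0 v1] := v01 x.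
  by rewrite le_max u0 ge_max u1 v1.
- move=> x a; rewrite gt_max => /andP[ua va].
  by apply: filterS2 (uscu _ _ ua) (uscv _ _ va) => y; rewrite gt_max => -> ->.
- apply: (@subclosed_compact _ _ (support0 u `|` support0 v)).
  + exact: closed_closure.
  + exact: compactU.
  + rewrite /support0 -closureU; apply: closureS => x /=.
    by rewrite lt_max => /orP[]; [left|right].
Qed.

Lemma subnormal_min (c : R) u :
  0 <= c -> subnormal u -> subnormal (fun x => Num.min c (u x)).
Proof.
move=> c0 [u01 uscu cu]; split.
- move=> x; have /andP[u0 u1] := u01 x.
  by rewrite le_min c0 u0 ge_min u1 orbT.
- move=> x a; rewrite gt_min => /orP[ca|ua].
    by apply: nearW => y; rewrite gt_min ca.
  by apply: filterS (uscu _ _ ua) => y ya; rewrite gt_min ya orbT.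
- apply: (@subclosed_compact _ _ (support0 u)) => //.
  + exact: closed_closure.
  + by apply: closureS => x /=; rewrite lt_min => /andP[].
Qed.

Lemma subnormal0 : subnormal (fun=> 0).
Proof.
split => [x|x a a0|]; first by rewrite lexx ler01.
  exact: nearW.
rewrite /support0 (_ : [set _ | _] = set0); last first.
  by apply/seteqP; split => x //=; rewrite ltxx.
by rewrite closure0; exact: compact0.
Qed.

Lemma subnormal_point (p : X) (a : R) :
  0 <= a <= 1 -> subnormal (fun x => if x == p then a else 0).
Proof.
move=> /andP[a0 a1].
have clp : closed [set p].
  by apply: compact_closed; [exact: metric_hausdorff|exact: compact_set1].
split.
- by move=> x; case: ifP => _; rewrite ?a0 ?a1 ?lexx ?ler01.
- move=> x b; case: eqVneq => [->|xp] xb.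
    by apply: nearW => y; case: ifP => // _; exact: le_lt_trans xb.
  have : (~` [set p]) x by move=> /= xp'; rewrite xp' eqxx in xp.
  move=> /(conj (closed_openC clp)) /open_nbhs_nbhs.
  by apply: filterS => y /= /eqP/negbTE ->.
- apply: (@subclosed_compact _ _ [set p]); first exact: closed_closure.
    exact: compact_set1.
  have /closure_id -> := clp.
  by apply: closureS => x /=; case: eqVneq => // _; rewrite ltxx.
Qed.

(** The points of [s] may repeat with different heights, hence only an inequality
in the first conclusion. *)
Lemma subnormal_finite (s : seq (X * R)) :
  (forall p, p \in s -> 0 <= p.2 <= 1) ->
  exists2 w, subnormal w &
    (forall p, p \in s -> p.2 <= w p.1) /\
    (forall y, w y = 0 \/ exists2 p, p \in s & p.1 = y /\ w y = p.2).
Proof.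
elim: s => [_|[q a] s IH s01].
  by exists (fun=> 0); [exact: subnormal0|split => // y; left].
have [p ps|w sw [wge wle]] := IH; first by apply: s01; rewrite inE ps orbT.
have a01 : 0 <= a <= 1 by apply: (s01 (q, a)); rewrite inE eqxx.
exists (fun x => Num.max (if x == q then a else 0) (w x)).
  by apply: subnormal_max => //; exact: subnormal_point.
split=> [p|y].
  rewrite inE => /predU1P[->/=|/wge pw]; first by rewrite eqxx le_max lexx.
  by rewrite le_max pw orbT.
have [w01 _ _] := sw.
have -> : Num.max (if y == q then a else 0) (w y) =
    if y == q then Num.max a (w y) else w y.
  case: ifP => // _; apply/max_idPr; by case/andP: (w01 y).
have wy : w y = 0 \/
    exists2 p, p \in (q, a) :: s & p.1 = y /\ w y = p.2.
  have [->|[p ps py]] := wle y; first by left.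
  by right; exists p => //; rewrite inE ps orbT.
case: eqVneq wy => // -> wy; have [wa|aw] := leP (w q) a; last exact: wy.
by right; exists (q, a); first by rewrite inE eqxx.
Qed.

End subnormal.

(** * Approximate images and the endograph metric *)

Section near_image.
Context {R : realType} {X : metricType R}.
Implicit Types (f : X -> X) (u v w : X -> R) (e : R).

(** Reading: [w'] is within [e] of the image of [w] under [f].  Heights at most [e]
are invisible to the endograph metric, because every endograph contains the
ground level.  In the first clause this needs no exception, since for a small
height [z := f y] does; in the second one the exception is real, as [x] need
not be close to the range of [f]. *)
Definition near_image f e w w' :=
  (forall y, exists2 z, mdist (f y) z <= e & w y <= w' z + e) /\
  (forall x, e < w' x -> exists2 y, mdist x (f y) <= e & w' x <= w y + e).

Lemma near_image_max f e u u' v v' :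
  near_image f e u u' -> near_image f e v v' ->
  near_image f e (fun x => Num.max (u x) (v x))
                 (fun x => Num.max (u' x) (v' x)).
Proof.
move=> [uu' u'u] [vv' v'v]; split=> [y|x].
  have [uv|vu] := leP (u y) (v y).
    have [z dz vz] := vv' y; exists z => //.
    by rewrite addr_maxl le_max vz orbT.
  have [z dz uz] := uu' y; exists z => //.
  by rewrite addr_maxl le_max uz.
have [uv|vu] := leP (u' x) (v' x).
  move=> /v'v[y dy vy]; exists y => //.
  by rewrite addr_maxl le_max vy orbT.
move=> /u'u[y dy uy]; exists y => //.
by rewrite addr_maxl le_max uy.
Qed.

Lemma near_image_min f e (c c' : R) u u' :
  `|c - c'| <= e -> near_image f e u u' ->
  near_image f e (fun x => Num.min c (u x)) (fun x => Num.min c' (u' x)).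
Proof.
rewrite ler_distl => /andP[cc' c'c] [uu' u'u]; split=> [y|x].
  have [z dz uz] := uu' y; exists z => //.
  by rewrite addr_minl le_min !ge_min uz orbT c'c.
rewrite lt_min => /andP[_ /u'u[y dy uy]]; exists y => //.
rewrite addr_minl le_min !ge_min uy orbT andbT.
by rewrite -lerBlDr cc'.
Qed.

(** The supremum defining the Zadeh extension is a maximum, so exact witnesses are
available with no loss in [e]. *)
Lemma zadeh_fun_attained f u x (a : R) : continuous f -> normal_fuzzy u ->
  0 < a -> a <= zadeh_fun f u x -> exists2 y, a <= u y & f y = x.
Proof.
move=> cf nu a0 ax; have : level (zadeh_fun f u) a x by [].
by rewrite level_zadeh_fun.
Qed.

Lemma near_image_zadeh f e u : continuous f -> normal_fuzzy u -> 0 <= e ->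
  near_image f e u (zadeh_fun f u).
Proof.
move=> cf nu e0; split=> [y|x ex].
  exists (f y); first by rewrite mdistxx.
  by rewrite (le_trans (zadeh_fun_ub f y nu))// lerDl.
have x0 := le_lt_trans e0 ex.
have [y uy fyx] := zadeh_fun_attained _ _ _ _ cf nu x0 (lexx _).
by exists y; rewrite ?fyx ?mdistxx// (le_trans uy)// lerDl.
Qed.

Lemma dist_prod_ge0 (p q : X * R) : 0 <= dist_prod p q.
Proof. by rewrite le_max normr_ge0 orbT. Qed.

Lemma dist_set_le (p c : X * R) (C : set (X * R)) :
  C c -> dist_set p C <= dist_prod p c.
Proof.
move=> Cc; apply: ge_inf; last by exists c.
by exists 0 => _ [q _ <-]; exact: dist_prod_ge0.
Qed.

Lemma fuzzy_bounds (u : fuzzy X) x : 0 <= u x <= 1.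
Proof. by have [u01 _ _ _] := fuzzy_normal u. Qed.

Lemma endograph_ground (u : fuzzy X) x : endograph u (x, 0).
Proof.
by case/andP: (fuzzy_bounds u x) => u0 _; rewrite /endograph/= lexx ler01.
Qed.

Lemma endograph_neq0 (u : fuzzy X) : endograph u !=set0.
Proof.
by have [_ _ _ [x _]] := fuzzy_normal u; exists (x, 0); exact: endograph_ground.
Qed.

Lemma dist_endo_le (u v : fuzzy X) e :
  (forall p, endograph u p -> exists2 c, endograph v c & dist_prod p c <= e) ->
  (forall p, endograph v p -> exists2 c, endograph u c & dist_prod p c <= e) ->
  dist_endo u v <= e.
Proof.
move=> uv vu; rewrite ge_max; apply/andP; split; apply: ge_sup.
- by have [p up] := endograph_neq0 u; exists (dist_set p (endograph v)), p.
- by move=> _ [p /uv[c vc pc] <-]; apply: le_trans pc; exact: dist_set_le.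
- by have [p vp] := endograph_neq0 v; exists (dist_set p (endograph u)), p.
- by move=> _ [p /vu[c uc pc] <-]; apply: le_trans pc; exact: dist_set_le.
Qed.

(** The supremum in the Hausdorff distance is a real one, and bounds its elements
only because the set is bounded: any point of [endograph v] is within 1 of the
ground level, which lies in [endograph u]. *)
Lemma dist_endo_lt (u v : fuzzy X) e p : dist_endo u v < e -> endograph v p ->
  exists2 c, endograph u c & dist_prod p c < e.
Proof.
rewrite gt_max => /andP[_ vu] vp.
have : dist_set p (endograph u) < e.
  apply: le_lt_trans vu; apply: ub_le_sup; last by exists p.
  exists 1 => _ [[x a] [/= /andP[a0 a1] _] <-].
  apply: le_trans (dist_set_le _ _ _ (endograph_ground u x)) _.
  by rewrite /dist_prod/= mdistxx subr0 ge_max ler01 ger0_norm.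
move=> /inf_lt[|_ [c uc <-] pc]; last by exists c.
by have [c uc] := endograph_neq0 u; exists (dist_prod p c), c.
Qed.

Lemma dist_endo_near_image f (cf : continuous f) e (w w' : fuzzy X) : 0 <= e ->
  near_image f e w w' -> dist_endo (zadeh cf w) w' <= e.
Proof.
move=> e0 [ww' w'w]; apply: dist_endo_le => -[x a] [/= /andP[a0 a1] ax].
  move: a0; rewrite le_eqVlt => /predU1P[<-|a0].
    exists (x, 0); first exact: endograph_ground.
    by rewrite /dist_prod/= mdistxx subrr normr0 ge_max e0.
  have [y ay <-] := zadeh_fun_attained _ _ _ _ cf (fuzzy_normal w) a0 ax.
  have [z dz wz] := ww' y; exists (z, Num.max 0 (a - e)); last first.
    rewrite /dist_prod/= ge_max dz/= ler_distl.
    by case: (leP 0 (a - e)) => ?; apply/andP; split; lra.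
  rewrite /endograph/= le_max lexx/= ge_max ler01/= ge_max.
  have /andP[-> _] := fuzzy_bounds w' z; split=> /=; lra.
have [ae|ea] := leP a e.
  exists (x, 0); first exact: endograph_ground.
  by rewrite /dist_prod/= mdistxx subr0 ge_max e0 ger0_norm.
have [y dy wy] := w'w x (lt_le_trans ea ax).
have zy := zadeh_fun_ub f y (fuzzy_normal w).
exists (f y, a - e); first by rewrite /endograph/=; split; lra.
by rewrite /dist_prod/= ge_max dy opprB addrCA subrr addr0 ger0_norm ?lexx.
Qed.

End near_image.

(** * Approximate preimages *)

Section approximate_preimage.
Context {R : realType} {X : metricType R} (f : X -> X).

(** Every [x] has a neighbourhood where [v] stays below [v x + e]; finitely many of
them cover the support of [v].  Giving height [v x] to an approximate preimage
[h x] of each of their centers [x] yields a fuzzy set whose image is close to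
[v]. *)
Lemma near_image_dense (e : R) (v : fuzzy X) : dense (range f) -> 0 < e ->
  exists w : fuzzy X, near_image f e w v.
Proof.
move=> df e0; have e20 : 0 < e / 2 by rewrite divr_gt0.
have [v01 uscv cv [x0 vx0]] := fuzzy_normal v.
have hP x : exists y, mdist x (f y) < e / 2.
  have [z [] /=] := df (ball x (e / 2))° (ex_intro _ x (nbhsx_ballx x _ e20))
    (@open_interior _ _).
  move=> /interior_subset; rewrite ballEmdist/= => xy [y _ yx].
  by exists y; rewrite yx.
have [h hE] := choice hP.
pose N x := (ball x (e / 2) `&` [set y | v y < v x + e])°.
(* The cover form of compactness is stated on pointed spaces. *)
pose Xp : ptopologicalType := HB.pack X (isPointed.Build X x0).
have : @cover_compact Xp (support0 v) by rewrite -compact_cover.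
move=> /(_ _ setT N)[x _|x _|D _ vD].
- exact: open_interior.
- exists x => //; apply: filterI; first exact: nbhsx_ballx.
  by apply: uscv; rewrite ltrDl.
(* The peak [x0] of [v] joins the centers so that [w] reaches height 1. *)
have [|w sw [wge wle]] := @subnormal_finite R X
    [seq (h x, v x) | x <- x0 :: finmap.enum_fset D].
  by move=> _ /mapP[x _ ->] /=.
have vwh x : x \in x0 :: finmap.enum_fset D -> v x <= w (h x).
  by move=> xD; apply: (wge (h x, v x)); apply/mapP; exists x.
have nw : normal_fuzzy w.
  apply: (@subnormal_normal _ _ _ (h x0)) => //; apply/eqP; rewrite eq_le.
  have [w01 _ _] := sw; case/andP: (w01 (h x0)) => _ ->/=.
  by apply: le_trans vx0 _; apply: vwh; rewrite inE eqxx.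
exists (Fuzzy nw); split => /= [y|x vx].
  have [->|[_ /mapP[x _ ->] /= [<- ->]]] := wle y.
    exists (f y); first by rewrite mdistxx ltW.
    by have /andP[] := fuzzy_bounds v (f y); lra.
  by exists x; [rewrite metric_sym; have := hE x|]; lra.
have [|z zD /interior_subset[]] := vD x.
  by apply: subset_closure => /=; exact: lt_trans vx.
rewrite ballEmdist/= => zx vxz; exists (h z).
  have := metric_triangle x z (f (h z)); rewrite (metric_sym x z).
  by have := hE z; lra.
have : v z <= w (h z) by apply: vwh; rewrite inE; apply/orP; right.
lra.
Qed.

End approximate_preimage.

(** * The chain conditions *)

Section chain_conditions.
Context {R : realType} {X : metricType R} (f : X -> X) (cf : continuous f).

Lemma fuzzy_eq (u v : fuzzy X) : (forall x, u x = v x) -> u = v.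
Proof.
case: u v => [u nu] [v nv] /= /funext uv; case: _ / uv nv => nv.
by congr Fuzzy; exact: Prop_irrelevance.
Qed.

(** Whichever of the two heights is at least 1, the part truncated there keeps its
peak. *)
Lemma fuzzy_blend (c b : R) (u v : fuzzy X) : 0 <= c -> 0 <= b ->
  1 <= c \/ 1 <= b ->
  normal_fuzzy (fun x => Num.max (Num.min c (u x)) (Num.min b (v x))).
Proof.
move=> c0 b0 cb1; pose w x := Num.max (Num.min c (u x)) (Num.min b (v x)).
have sw : subnormal w.
  by apply: subnormal_max; apply: subnormal_min => //;
    apply: normal_subnormal; exact: fuzzy_normal.
have [w01 _ _] := sw.
suff [x wx] : exists x, 1 <= w x.
  by apply: (subnormal_normal _ x sw); apply/eqP; rewrite eq_le wx andbT;
    case/andP: (w01 x).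
have [c1|b1] := cb1.
  have [_ _ _ [x ux]] := fuzzy_normal u; exists x.
  by rewrite le_max le_min c1 ux.
have [_ _ _ [x vx]] := fuzzy_normal v; exists x.
by rewrite le_max !le_min b1 vx orbT.
Qed.

Lemma dense_chain_mixing :
  dense (range f) -> chain_mixing (@dist_endo R X) (zadeh cf).
Proof.
move=> df u v delta delta0; pose e := delta / 2.
have e0 : 0 < e by rewrite divr_gt0.
have [pre preP] := choice (fun w => near_image_dense f e w df e0).
pose N := (Num.bound (2 / e)).+1.
have Ne : 2 <= N%:R * e.
  have /archi_boundP := divr_ge0 (ler0n R 2) (ltW e0).
  by rewrite -ler_pdivrMr// => /ltW/le_trans; apply; rewrite ler_nat.
exists N => // n Nn; have ne : 2 <= n%:R * e.
  by apply: le_trans Ne _; rewrite ler_pM2r// ler_nat.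
pose b j : R := j%:R * e.
have b_ge0 j : 0 <= b j by rewrite mulr_ge0// ltW.
have yn j : normal_fuzzy (fun x => Num.max
    (Num.min (b (n - j)%N) (iter j (zadeh cf) u x))
    (Num.min (b j) (iter (n - j)%N pre v x))).
  apply: fuzzy_blend; rewrite ?b_ge0//.
  have : n%:R * e <= b j + b (n - j)%N.
    by rewrite /b -mulrDl -natrD ler_pM2r// ler_nat -leq_subLR.
  by case: (leP 1 (b j)) => ?; [right|left; lra].
have min1 (w : fuzzy X) x c : 1 <= c -> Num.min c (w x) = w x.
  move=> c1; apply/min_idPr.
  by case/andP: (fuzzy_bounds w x) => _ /le_trans; exact.
have min0 (w : fuzzy X) x : Num.min (b 0%N) (w x) = 0.
  by rewrite /b mul0r; apply/min_idPl; case/andP: (fuzzy_bounds w x).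
have bn1 : 1 <= b n by apply: le_trans ne; lra.
(* At time 0 the second part is cut at height 0 and the first is not cut at all;
   at time n it is the other way round. *)
exists (fun j => Fuzzy (yn j)); split.
- apply: fuzzy_eq => x /=; rewrite subn0 min0 min1//.
  by apply/max_idPl; case/andP: (fuzzy_bounds u x).
- apply: fuzzy_eq => x /=; rewrite subnn min0 min1//.
  by apply/max_idPr; case/andP: (fuzzy_bounds v x).
- move=> j jn; apply: (@le_lt_trans _ _ e); last by rewrite /e; lra.
  apply: dist_endo_near_image; first exact: ltW.
  have nj : (n - j = (n - j.+1).+1)%N by rewrite -subSn.
  have bS k : b k.+1 = b k + e by rewrite /b -natr1 mulrDl mul1r.
  apply: near_image_max; apply: near_image_min.
  + by rewrite nj bS addrAC subrr add0r ger0_norm// ltW.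
  + apply: near_image_zadeh => //; [exact: fuzzy_normal|exact: ltW].
  + by rewrite bS opprD addrA subrr add0r normrN ger0_norm// ltW.
  + by rewrite nj; exact: preP.
Qed.

Lemma chain_mixing_transitive (Y : Type) (r : Y -> Y -> R) (g : Y -> Y) :
  chain_mixing r g -> chain_transitive r g.
Proof. by move=> mix a b d /(mix a b)[n n0 nP]; exists n => //; exact: nP. Qed.

Lemma chain_transitive_recurrent (Y : Type) (r : Y -> Y -> R) (g : Y -> Y) :
  chain_transitive r g -> chain_recurrent r g.
Proof. by move=> tr a; exact: tr. Qed.

Lemma chain_recurrent_dense :
  chain_recurrent (@dist_endo R X) (zadeh cf) -> dense (range f).
Proof.
move=> rec O [x Ox] oO.
have [d /= d0 dO] : exists2 d : R, 0 < d & ball x d `<=` O.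
  by apply/nbhs_ballP; exact: open_nbhs_nbhs.
have nx : normal_fuzzy (fun y => if y == x then 1 else 0 : R).
  apply: (subnormal_normal _ x); last by rewrite eqxx.
  by apply: subnormal_point; rewrite ler01 lexx.
(* Radius at most 1: then the height found near 1 below is positive. *)
have d10 : 0 < Num.min d 1 by rewrite lt_min d0 ltr01.
have [[//|m] _ [y [_ ym ych]]] := rec (Fuzzy nx) _ d10.
have nx1 : endograph (Fuzzy nx) (x, 1) by rewrite /endograph/= eqxx ler01 lexx.
have := ych m (ltnSn m); rewrite ym => /dist_endo_lt /(_ nx1)[[z a] [/= _ az]].
rewrite /dist_prod gt_max !lt_min /= => /andP[/andP[xz _] /andP[_ a1]].
have a0 : 0 < a by move: a1; rewrite ltr_distl; lra.
have [t _ tz] := zadeh_fun_attained _ _ _ _ cf (fuzzy_normal (y m)) a0 az.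
by exists z; split; [apply: dO; rewrite ballEmdist|exists t].
Qed.

End chain_conditions.

Theorem theorem4p3 (R : realType) (X : metricType R) (f : X -> X)
    (cf : continuous f) :
  [<-> dense (range f);
       chain_recurrent (@dist_endo R X) (zadeh cf);
       chain_transitive (@dist_endo R X) (zadeh cf);
       chain_mixing (@dist_endo R X) (zadeh cf)].
Proof.
have mt := @chain_mixing_transitive R _ (@dist_endo R X) (zadeh cf).
have tr := @chain_transitive_recurrent R _ (@dist_endo R X) (zadeh cf).
have rd := chain_recurrent_dense f cf.
have dm := dense_chain_mixing f cf.
by tfae => [/dm/mt/tr|/rd/dm/mt|/tr/rd/dm|/mt/tr/rd].
Qed.
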